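(* Let $G$ be a connected finite simple graph with vertex set $\{1,\dots,p\}$ and $q$ edges, where $q\neq 1$. Then the automorphism group of the graphicahedron $\mathcal{P}_G$ is $\Gamma(\mathcal{P}_G)= S_p\ltimes \Gamma(G)$, where $\Gamma(G)$ is the automorphism group of the graph $G$. Here $S_p$ acts on $\mathcal{P}_G$ by $(K,\alpha)\mapsto(K,\alpha\gamma)$ ($\gamma\in S_p$), a graph automorphism $\kappa$ of $G$ (viewed as a permutation of $\{1,\dots,p\}$ that also permutes edges) acts by $(K,\alpha)\mapsto(\kappa(K),\kappa\alpha\kappa^{-1})$, and $\Gamma(G)$ normalizes $S_p$ via conjugation.
   Context: For an edge $e=\{i,j\}$ of $G$ let $\tau_e=(i\;j)\in S_p$. For $K\subseteq E(G)$ let $T_K=\langle \tau_e : e\in K\rangle\le S_p$ (trivial if $K=\emptyset$). The graphicahedron $\mathcal{P}_G$ is the poset whose elements are the pairs $(K,\alpha)$, $K\subseteq E(G)$, $\alpha\in S_p$, modulo $(K,\alpha)\sim(L,\beta)$ iff $K=L$ and $T_K\alpha=T_L\beta$, ordered by $(K,\alpha)\le(L,\beta)$ iff $K\subseteq L$ and $T_K\alpha\subseteq T_L\beta$, with rank of $(K,\alpha)$ equal to $|K|$, together with an adjoined least element of rank $-1$. $\Gamma(\mathcal{P}_G)$ denotes the group of order-preserving bijections of $\mathcal{P}_G$. *)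

(* Defs.v *)
From HB Require Import structures.
From mathcomp Require Import all_boot all_order all_fingroup.

Set Implicit Arguments.
Unset Strict Implicit.
Unset Printing Implicit Defensive.

Import GroupScope.
Local Open Scope quotient_scope.

(* fingroup shadows the representative function of generic_quotient. *)
Local Notation crepr := generic_quotient.repr.

(* The vertex set {1, ..., p} is encoded as 'I_p. *)

(* MathComp multiplies permutations from left to right, (a * b) x = b (a x).
   All products of permutations below are compositions of functions, from
   right to left.  This is the convention for which
   kappa (i j) kappa^-1 = (kappa i kappa j), so that the action of a graph
   automorphism on pairs (K, alpha) is compatible with the equivalence. *)
Definition pcomp (T : finType) (a b : {perm T}) : {perm T} := b * a.

Notation "a \oc b" := (pcomp a b) (at level 40, left associativity).

Lemma pcompE (T : finType) (a b : {perm T}) x : (a \oc b) x = a (b x).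
Proof. exact: permM. Qed.

Record sgraph (p : nat) := SGraph {
  adj :> rel 'I_p;
  adj_sym : symmetric adj;
  adj_irr : irreflexive adj }.

Fact graphicahedron_display : Order.disp_t.
Proof. exact: Order.Disp tt tt. Qed.

Section Graphicahedron.
Variables (p : nat) (G : sgraph p).
Implicit Types (K L : {set {set 'I_p}}) (a b g k : 'S_p).

Definition connected_graph : Prop :=
  0 < p /\ forall i j : 'I_p, connect (adj G) i j.

Definition edges : {set {set 'I_p}} :=
  [set [set ij.1; ij.2] | ij : 'I_p * 'I_p & G ij.1 ij.2].

Definition graph_aut : {set 'S_p} :=
  [set k : 'S_p | [forall i, forall j, G (k i) (k j) == G i j]].

Lemma graph_autP k :
  reflect (forall i j, G (k i) (k j) = G i j) (k \in graph_aut).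
Proof.
rewrite inE; apply: (iffP forallP) => h i; last first.
  by apply/forallP => j; apply/eqP.
by move=> j; apply/eqP; have /forallP := h i.
Qed.

Lemma graph_aut_group_set : group_set graph_aut.
Proof.
apply/group_setP; split=> [|a b /graph_autP ha /graph_autP hb].
  by apply/graph_autP => i j; rewrite !perm1.
by apply/graph_autP => i j; rewrite !permM hb ha.
Qed.
Canonical graph_aut_group := Group graph_aut_group_set.

Definition Tgrp K : {group 'S_p} :=
  <<[set tperm ij.1 ij.2 | ij : 'I_p * 'I_p & [set ij.1; ij.2] \in K]>>%G.

Definition Tcoset K a : {set 'S_p} := [set t \oc a | t in Tgrp K].

Lemma TcosetE K a : Tcoset K a = a *: Tgrp K.
Proof. by apply/setP => x; rewrite -lcosetE. Qed.

Definition precell := {x : {set {set 'I_p}} * 'S_p | x.1 \subset edges}.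

Definition cell_equiv : rel precell := fun x y =>
  ((val x).1 == (val y).1) &&
  (Tcoset (val x).1 (val x).2 == Tcoset (val y).1 (val y).2).

Lemma cell_equiv_refl : reflexive cell_equiv.
Proof. by move=> x; rewrite /cell_equiv !eqxx. Qed.

Lemma cell_equiv_sym : symmetric cell_equiv.
Proof.
by move=> x y; rewrite /cell_equiv eq_sym [Tcoset _ _ == _]eq_sym.
Qed.

Lemma cell_equiv_trans : transitive cell_equiv.
Proof.
move=> y x z /andP[/eqP e1 /eqP e2] /andP[/eqP e3 /eqP e4].
by rewrite /cell_equiv e2 e4 e1 e3 !eqxx.
Qed.

Canonical cell_equiv_rel :=
  EquivRel cell_equiv cell_equiv_refl cell_equiv_sym cell_equiv_trans.

Definition cell := {eq_quot cell_equiv_rel}.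

HB.instance Definition _ := Choice.on cell.
HB.instance Definition _ := Choice_isCountable.Build cell
  (pcan_pickleK (can_pcan (@reprK precell cell))).
HB.instance Definition _ : isFinite cell :=
  CanIsFinite (@reprK precell cell).

Definition Cell K (sKE : K \subset edges) a : cell :=
  \pi_cell (Sub (K, a) sKE : precell).

Lemma pi_cell_eq (x y : precell) :
  (\pi_cell x == \pi_cell y) = cell_equiv x y.
Proof. exact: eqmodE. Qed.

Lemma cellP (c : cell) : exists x : precell, c = \pi_cell x.
Proof. by exists (crepr c); rewrite reprK. Qed.

Lemma repr_cell (x : precell) : cell_equiv (crepr (\pi_cell x)) x.
Proof. by rewrite -pi_cell_eq reprK. Qed.

Lemma Cell_eq K (sK : K \subset edges) L (sL : L \subset edges) a b :
  (Cell sK a == Cell sL b) = (K == L) && (Tcoset K a == Tcoset L b).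
Proof. exact: pi_cell_eq. Qed.

(* None is the adjoined least element. *)
Definition graphicahedron : Type := option cell.

HB.instance Definition _ := Finite.on graphicahedron.

Definition precell_le (x y : precell) : bool :=
  ((val x).1 \subset (val y).1) &&
  (Tcoset (val x).1 (val x).2 \subset Tcoset (val y).1 (val y).2).

Definition graphicahedron_le (x y : graphicahedron) : bool :=
  match x, y with
  | None, _ => true
  | Some _, None => false
  | Some c, Some d => precell_le (crepr c) (crepr d)
  end.

Lemma graphicahedron_le_refl : reflexive graphicahedron_le.
Proof. by case=> //= c; rewrite /precell_le !subxx. Qed.

Lemma graphicahedron_le_anti : antisymmetric graphicahedron_le.
Proof.
case=> [c|] [d|] //= /andP[/andP[s1 t1] /andP[s2 t2]]; congr Some.
rewrite -[c]reprK -[d]reprK; apply/eqP; rewrite pi_cell_eq /cell_equiv.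
by rewrite !eqEsubset s1 s2 t1 t2.
Qed.

Lemma graphicahedron_le_trans : transitive graphicahedron_le.
Proof.
case=> [d|] [c|] [e|] //= /andP[s1 t1] /andP[s2 t2].
by rewrite /precell_le (subset_trans s1 s2) (subset_trans t1 t2).
Qed.

HB.instance Definition _ :=
  Order.Le_isPOrder.Build graphicahedron_display graphicahedron
    graphicahedron_le_refl graphicahedron_le_anti graphicahedron_le_trans.

Lemma le_Cell K (sK : K \subset edges) L (sL : L \subset edges) a b :
  ((Some (Cell sK a) : graphicahedron) <= (Some (Cell sL b) : graphicahedron))%O
  = (K \subset L) && (Tcoset K a \subset Tcoset L b).
Proof.
rewrite /Order.le /= /precell_le.
have /andP[/eqP-> /eqP->] := repr_cell (Sub (K, a) sK).
by have /andP[/eqP-> /eqP->] := repr_cell (Sub (L, b) sL).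
Qed.

Lemma le_None (x : graphicahedron) : ((None : graphicahedron) <= x)%O.
Proof. by []. Qed.

Definition Gamma : {set {perm graphicahedron}} :=
  [set s : {perm graphicahedron}
     | [forall x, forall y, (x <= y)%O ==> (s x <= s y)%O]].

Lemma GammaP (s : {perm graphicahedron}) :
  reflect {homo s : x y / (x <= y)%O} (s \in Gamma).
Proof.
rewrite inE; apply: (iffP forallP) => h x.
  by move=> y; apply/implyP; have /forallP := h x.
by apply/forallP => y; apply/implyP/h.
Qed.

Lemma Gamma_group_set : group_set Gamma.
Proof.
apply/group_setP; split=> [|s t /GammaP hs /GammaP ht].
  by apply/GammaP => x y; rewrite !perm1.
by apply/GammaP => x y xy; rewrite !permM; apply/ht/hs.
Qed.
Canonical Gamma_group := Group Gamma_group_set.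

(* By finiteness, the inverse of an order-preserving bijection is
   order-preserving. *)
Lemma Gamma_mono (s : {perm graphicahedron}) :
  s \in Gamma -> {mono s : x y / (x <= y)%O}.
Proof.
move=> hs x y; apply/idP/idP; last by apply/GammaP.
by have /groupVr/GammaP h := hs; move/h; rewrite !permK.
Qed.

Definition lift_cell (f : precell -> precell) (x : graphicahedron)
  : graphicahedron := omap (fun c => \pi_cell (f (crepr c))) x.

Lemma lift_cellE (f : precell -> precell) x :
  {homo f : x y / cell_equiv x y} ->
  lift_cell f (Some (\pi_cell x)) = Some (\pi_cell (f x)).
Proof.
by move=> hf; congr Some; apply/eqP; rewrite pi_cell_eq hf // repr_cell.
Qed.

Lemma Some_pi (x y : precell) :
  val x = val y -> Some (\pi_cell x) = Some (\pi_cell y) :> graphicahedron.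
Proof. by move/val_inj->. Qed.

(* The action (K, alpha) |-> (K, alpha gamma). *)

Definition pre_right_act g (x : precell) : precell :=
  Sub ((val x).1, (val x).2 \oc g) (valP x).

Lemma Tcoset_right_act K a g : Tcoset K (a \oc g) = g *: Tcoset K a.
Proof. by rewrite !TcosetE /pcomp lcosetM. Qed.

Lemma pre_right_act_equiv g : {homo pre_right_act g : x y / cell_equiv x y}.
Proof.
move=> x y /andP[/eqP e1 /eqP e2].
by rewrite /cell_equiv /= !Tcoset_right_act e2 e1 !eqxx.
Qed.

Lemma lift_right_actK g :
  cancel (lift_cell (pre_right_act g)) (lift_cell (pre_right_act g^-1)).
Proof.
case=> [c|//]; have [x ->] := cellP c.
rewrite (lift_cellE x (@pre_right_act_equiv g)).
rewrite (lift_cellE _ (@pre_right_act_equiv g^-1)).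
apply: Some_pi; case: x => [[K a] h] /=.
by rewrite /pcomp mulKg.
Qed.

Definition right_act g : {perm graphicahedron} :=
  perm (can_inj (@lift_right_actK g)).

Lemma right_act_Cell K (sK : K \subset edges) a g :
  right_act g (Some (Cell sK a)) = Some (Cell sK (a \oc g)).
Proof.
rewrite permE lift_cellE; last exact: pre_right_act_equiv.
by apply: Some_pi.
Qed.

Lemma right_act_None g : right_act g None = None.
Proof. by rewrite permE. Qed.

(* The action (K, alpha) |-> (kappa(K), kappa alpha kappa^-1) of
   kappa in Gamma(G).  The default value of insubd is not used when kappa is a
   graph automorphism; other permutations are sent to the identity. *)

Definition edges_img k K : {set {set 'I_p}} :=
  [set k @: (e : {set 'I_p}) | e in K].

Definition pre_graph_act k (x : precell) : precell :=
  insubd x (edges_img k (val x).1, k \oc (val x).2 \oc k^-1).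

Lemma edges_img_sub k K :
  k \in graph_aut -> K \subset edges -> edges_img k K \subset edges.
Proof.
move=> /graph_autP hk sK; apply/subsetP => _ /imsetP[e eK ->].
have /imsetP[[i j] /= ] := subsetP sK e eK; rewrite inE /= => Gij ->.
by apply/imsetP; exists (k i, k j); rewrite ?inE /= ?hk // imsetU1 imset_set1.
Qed.

Lemma val_pre_graph_act k x : k \in graph_aut ->
  val (pre_graph_act k x) = (edges_img k (val x).1, k \oc (val x).2 \oc k^-1).
Proof. by move=> hk; rewrite insubdK //; apply: edges_img_sub (valP x). Qed.

Lemma edges_imgM k g K : edges_img (k \oc g) K = edges_img k (edges_img g K).
Proof.
rewrite /edges_img -imset_comp; apply: eq_imset => e.
by rewrite /= -imset_comp; apply: eq_imset => i; rewrite pcompE.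
Qed.

Lemma edges_img1 K : edges_img 1 K = K.
Proof.
rewrite /edges_img -[RHS]imset_id; apply: eq_imset => e.
by rewrite -[RHS]imset_id; apply: eq_imset => i; rewrite perm1.
Qed.

Lemma Tgrp_img k K : Tgrp (edges_img k K) = Tgrp K :^ k :> {set 'S_p}.
Proof.
rewrite /= -genJ; congr <<_>>; apply/setP => s; apply/imsetP/imsetP.
  case=> -[i j]; rewrite inE /= => /imsetP[e eK ije] ->.
  have {ije} e_ij : e = [set k^-1 i; k^-1 j].
    apply: (imset_inj (@perm_inj _ k)).
    by rewrite -ije imsetU1 imset_set1 !permKV.
  exists (tperm (k^-1 i) (k^-1 j)); last by rewrite tpermJ !permKV.
  by apply/imsetP; exists (k^-1 i, k^-1 j); rewrite ?inE //= -e_ij.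
case=> t /imsetP[[i j]]; rewrite inE /= => ijK -> ->.
exists (k i, k j); last by rewrite tpermJ.
rewrite inE /=; apply/imsetP; exists [set i; j] => //.
by rewrite imsetU1 imset_set1.
Qed.

Lemma Tcoset_graph_act k K a :
  Tcoset (edges_img k K) (k \oc a \oc k^-1) = Tcoset K a :^ k.
Proof. by rewrite !TcosetE Tgrp_img conjsMg conjg_set1 /pcomp. Qed.

Lemma pre_graph_act_equiv k : k \in graph_aut ->
  {homo pre_graph_act k : x y / cell_equiv x y}.
Proof.
move=> hk x y /andP[/eqP e1 /eqP e2].
by rewrite /cell_equiv !val_pre_graph_act //= !Tcoset_graph_act e2 e1 !eqxx.
Qed.

Definition graph_act_fun k : graphicahedron -> graphicahedron :=
  if k \in graph_aut then lift_cell (pre_graph_act k) else id.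

Lemma graph_act_funK k : cancel (graph_act_fun k) (graph_act_fun k^-1).
Proof.
rewrite /graph_act_fun groupV; case: ifP => // hk [c|//].
have hkV : k^-1 \in graph_aut by rewrite groupV.
have [x ->] := cellP c.
rewrite (lift_cellE x (pre_graph_act_equiv hk)).
rewrite (lift_cellE _ (pre_graph_act_equiv hkV)).
apply: Some_pi; rewrite !val_pre_graph_act //=.
case: x => [[K a] h] /=; rewrite -edges_imgM /pcomp mulgV edges_img1.
by rewrite invgK mulgA mulgA mulgV mul1g mulgK.
Qed.

Definition graph_act k : {perm graphicahedron} :=
  perm (can_inj (@graph_act_funK k)).

Lemma graph_act_Cell k (hk : k \in graph_aut) K (sK : K \subset edges) a :
  graph_act k (Some (Cell sK a))
  = Some (Cell (edges_img_sub hk sK) (k \oc a \oc k^-1)).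
Proof.
rewrite permE /graph_act_fun hk lift_cellE; last exact: pre_graph_act_equiv.
by apply: Some_pi; rewrite val_pre_graph_act.
Qed.

Lemma graph_act_None k : graph_act k None = None.
Proof. by rewrite permE /graph_act_fun; case: ifP. Qed.

End Graphicahedron.

(* Main.v *)
Require Import Defs.
From mathcomp Require Import all_boot all_order all_fingroup.

(* An automorphism of the poset preserves the number 2 ^ (q - |K|) of elements
   above (K, alpha), hence the rank, so it induces a map f on the vertices and,
   at each vertex, a permutation of the edge labels.  Rank two faces show that
   this permutation is the same at all vertices.  Once f fixes the identity
   (compose with a right translation), f is therefore an automorphism of S_p
   sending each tau_e to some tau_e'.  All transpositions being conjugate, f
   preserves transpositions, hence is the conjugation by some kappa, and kappa
   is a graph automorphism.  This replaces Whitney's theorem on line graphs.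
   Finally an automorphism fixing all vertices is trivial. *)

Set Implicit Arguments.
Unset Strict Implicit.
Unset Printing Implicit Defensive.

Import GroupScope.

(** * Generated subgroups and two-element sets *)

(** In a finite group every element of [<<A>>] is a product of elements of [A] without inverses, so
    induction on the length of the product suffices. *)
Lemma gen_ind (gT : finGroupType) (A : {set gT}) (P : gT -> Prop) :
    P 1 -> (forall x a, P x -> a \in A -> P (x * a)) ->
  {in <<A>>, forall x, P x}.
Proof.
move=> P1 PM x /gen_prodgP[n [c cA ->]].
elim: n c cA => [|n IHn] c cA; first by rewrite big_ord0.
by rewrite big_ord_recr; apply: PM => //; apply: IHn => i; apply: cA.
Qed.

Lemma eq_set2 (T : finType) (x y i j : T) : [set x; y] = [set i; j] ->
  (x = i /\ y = j) \/ (x = j /\ y = i).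
Proof.
move=> e; have: x \in [set i; j] by rewrite -e set21.
have: y \in [set i; j] by rewrite -e set22.
have: i \in [set x; y] by rewrite e set21.
have: j \in [set x; y] by rewrite e set22.
rewrite !inE => jxy ixy /pred2P[] ey /pred2P[] ex; subst; auto.
  by move: jxy; rewrite orbb => /eqP->; left.
by move: ixy; rewrite orbb => /eqP->; left.
Qed.

(** * Transpositions, and injective endomorphisms of the symmetric group preserving them *)

Section Permutations.
Variable T : finType.
Implicit Types (x y z : T) (k : {perm T}).

Lemma third_point x y : #|T| != 2 -> x != y -> exists2 z, z != x & z != y.
Proof.
move=> nT2 nxy; have /subsetPn[z _] : ~~ ([set: T] \subset [set x; y]).
  apply: contra nT2 => sT; rewrite -cardsT.
  have /eqP-> : [set: T] == [set x; y] by rewrite eqEsubset sT subsetT.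
  by rewrite cards2 nxy.
by rewrite !inE negb_or => /andP[? ?]; exists z.
Qed.

(** If [k] moves [x], a transposition that fixes [x] and moves [k x] does not commute with [k]; it
    takes a third point to build one. *)
Lemma perm_center_trivial k : #|T| != 2 -> (forall a, commute k a) -> k = 1.
Proof.
move=> nT2 ck; apply/permP => x; rewrite perm1; apply/eqP/negPn/negP => nkx.
have [z nzk nzx] := third_point nT2 nkx.
have /permP/(_ x) := ck (tperm (k x) z).
by rewrite !permM tpermL (tpermD nkx nzx) => /eqP; rewrite (negPf nzk).
Qed.

Lemma tperm_moved x y z : tperm x y z != z -> tperm x y = tperm z (tperm x y z).
Proof. by case: (tpermP x y z) => [->|->|_ _]; rewrite ?eqxx // tpermC. Qed.

Lemma tperm_commute_disjoint x y z w :
  x != z -> x != w -> y != z -> y != w -> commute (tperm x y) (tperm z w).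
Proof.
move=> xz xw yz yw; apply/commgP/conjg_fixP.
by rewrite tpermJ !tpermD // eq_sym.
Qed.

Lemma tperm_not_commute x y z :
  x != y -> x != z -> y != z -> ~ commute (tperm x y) (tperm x z).
Proof.
move=> xy xz yz /permP/(_ y); rewrite !permM tpermR tpermL.
rewrite (@tpermD _ x z y) ?(eq_sym z) // tpermR => /eqP.
by rewrite eq_sym (negPf xz).
Qed.

Lemma eq_tperm x y z w : x != y -> tperm x y = tperm z w ->
  (x = z /\ y = w) \/ (x = w /\ y = z).
Proof.
move=> nxy e; have := tpermL x y; rewrite e.
case: tpermP => [-> ->|-> ->|_ _ xy]; auto.
by rewrite xy eqxx in nxy.
Qed.

Lemma tperm_neq1 x y : (tperm x y == 1) = (x == y).
Proof.
apply/eqP/eqP => [/permP/(_ x)|->]; last exact: tperm1.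
by rewrite tpermL perm1.
Qed.

Lemma tperm_conj x y k : k ^ tperm x y = tperm x y * k * tperm x y.
Proof. by rewrite conjgE tpermV mulgA. Qed.

(* The images of the transpositions [tperm x0 z] pairwise fail to commute, so
   the pairs they exchange pairwise meet; the images for [x1] and [x2] single
   out a point [u], and no other pair can avoid [u] because it would then be
   the pair attached to [tperm x1 x2]. *)
Lemma tperm_automorphism_inner (f : {perm T} -> {perm T}) :
    #|T| != 2 -> injective f -> {morph f : a b / a * b} ->
    (forall x y, x != y -> exists x' y', f (tperm x y) = tperm x' y') ->
  exists k, forall a, f a = a ^ k.
Proof.
move=> nT2 injf fM ftp.
have [T1|] := leqP #|T| 1.
  by exists 1 => a; apply/permP => x; apply: (fintype_le1P T1).
case/card_gt1P=> x0 [x1 [_ _ n01]].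
have [x2 n20 n21] := third_point nT2 n01.
have f1 : f 1 = 1 by apply: (mulgI (f 1)); rewrite -fM !mulg1.
have fcomm a b : commute (f a) (f b) -> commute a b.
  by rewrite /commute -!fM => /injf.
(* Disjoint transpositions commute, and [f] reflects commutation, whereas [tperm x0 z] and
   [tperm x0 w] do not commute. *)
have meet z w a b c d : x0 != z -> x0 != w -> z != w ->
    f (tperm x0 z) = tperm a b -> f (tperm x0 w) = tperm c d ->
    [|| a == c, a == d, b == c | b == d].
  move=> n0z n0w nzw fz fw; apply: contraT; rewrite !negb_or.
  case/and4P=> ac ad bc bd; case: (tperm_not_commute n0z n0w nzw).
  by apply: fcomm; rewrite fz fw; apply: tperm_commute_disjoint.
have n02 : x0 != x2 by rewrite eq_sym.
have n12 : x1 != x2 by rewrite eq_sym.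
have [u [v [w [fx1 fx2]]]] : exists u v w,
    f (tperm x0 x1) = tperm u v /\ f (tperm x0 x2) = tperm u w.
  have [a [b f01]] := ftp _ _ n01; have [c [d f02]] := ftp _ _ n02.
  case/or4P: (meet _ _ _ _ _ _ n01 n02 n12 f01 f02) => /eqP e; subst.
  - by exists c, b, d.
  - by exists d, b, c; rewrite f01 f02 (tpermC c).
  - by exists c, a, d; rewrite f01 f02 (tpermC a).
  - by exists d, a, c; rewrite f01 f02 (tpermC a) (tpermC c).
have nuv : u != v by rewrite -tperm_neq1 -fx1 -f1 (inj_eq injf) tperm_neq1.
have nuw : u != w by rewrite -tperm_neq1 -fx2 -f1 (inj_eq injf) tperm_neq1.
have nvw : v != w.
  apply: contra n12 => /eqP e; apply/eqP.
  have /injf/permP/(_ x0) : f (tperm x0 x1) = f (tperm x0 x2) by rewrite fx1 fx2 e.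
  by rewrite !tpermL.
(* [tperm x1 x2] is a conjugate of [tperm x0 x2] by [tperm x0 x1], and [f] respects this product. *)
have f12 : f (tperm x1 x2) = tperm v w.
  have -> : tperm x1 x2 = tperm x0 x1 * tperm x0 x2 * tperm x0 x1.
    by rewrite -tperm_conj tpermJ tpermL tpermD.
  by rewrite !fM fx1 fx2 -tperm_conj tpermJ tpermL tpermD // eq_sym.
have fu z : x0 != z -> f (tperm x0 z) u != u.
  move=> n0z; have [<-|n1z] := eqVneq x1 z; first by rewrite fx1 tpermL eq_sym.
  have [<-|n2z] := eqVneq x2 z; first by rewrite fx2 tpermL eq_sym.
  have [c [d fz]] := ftp _ _ n0z.
  have ncd : c != d by rewrite -tperm_neq1 -fz -f1 (inj_eq injf) tperm_neq1.
  rewrite fz; case: tpermP => [->|->|/eqP nuc /eqP nud] //.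
    by rewrite eq_sym.
  have := meet _ _ _ _ _ _ n01 n0z n1z fx1 fz.
  have := meet _ _ _ _ _ _ n02 n0z n2z fx2 fz.
  (* A pair avoiding [u] must meet [{u, v}] in [v] and [{u, w}] in [w]. It is then [{v, w}], which
     contradicts injectivity, since only [tperm x0 z] moves [x0]. *)
  rewrite (negPf nuc) (negPf nud) /= => wcd vcd.
  have e : tperm c d = tperm v w.
    case/orP: wcd vcd nvw => /eqP-> /orP[]/eqP->; rewrite ?eqxx //.
    by rewrite tpermC.
  have /injf/permP/(_ x0) : f (tperm x0 z) = f (tperm x1 x2) by rewrite fz e f12.
  rewrite tpermL tpermD 1?eq_sym // => e0.
  by rewrite e0 eqxx in n0z.
(* The conjugating permutation sends [z] to the partner of [u] in the image of [tperm x0 z]. It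
   sends [x0] to [u], because [tperm x0 x0 = 1]. *)
pose k0 z := f (tperm x0 z) u.
have fk z : f (tperm x0 z) = tperm u (k0 z).
  have [<-|n0z] := eqVneq x0 z; first by rewrite /k0 tperm1 f1 perm1 tperm1.
  rewrite /k0; have [c [d fz]] := ftp _ _ n0z.
  by move: (fu _ n0z); rewrite fz; apply: tperm_moved.
have k0_inj : injective k0.
  move=> z w' e; have /injf/permP/(_ x0) : f (tperm x0 z) = f (tperm x0 w').
    by rewrite !fk e.
  by rewrite !tpermL.
exists (perm k0_inj) => a.
(* The transpositions through [x0] generate the whole symmetric group, so it is enough to compare
   both morphisms on them. *)
have: a \in <<[set tperm x0 y | y in T]>> by rewrite gen_tperm inE.
move: a; apply: gen_ind => [|a _ fa /imsetP[z _ ->]]; first by rewrite f1 conj1g.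
have k00 : k0 x0 = u by rewrite /k0 tperm1 f1 perm1.
by rewrite fM fa conjMg fk tpermJ !permE k00.
Qed.

End Permutations.

(** * Faces of the graphicahedron, their order and their number *)

Section Faces.
Variables (p : nat) (G : sgraph p).
Implicit Types (K L M : {set {set 'I_p}}) (a b t : 'S_p).
Local Notation E := (edges G).
Local Notation P := (graphicahedron G).

(* The junk value [None] is taken when [K] is not a set of edges. *)
Definition face K a : P :=
  omap (fun x : precell G => \pi_(cell G)%qT x) (insub (K, a)).

Lemma face_Cell K (sK : K \subset E) a : face K a = Some (Cell sK a).
Proof. by rewrite /face insubT. Qed.

Lemma faceP (x : P) : x = None \/ exists K a, K \subset E /\ x = face K a.
Proof.
case: x => [c|]; [right | by left].
have [[[K a] /= sK] ->] := cellP c.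
by exists K, a; rewrite (face_Cell sK).
Qed.

Lemma face_neq_None K a : K \subset E -> face K a <> None.
Proof. by move=> sK; rewrite (face_Cell sK). Qed.

Lemma Tgrp_sub K L : K \subset L -> Tgrp K \subset Tgrp L.
Proof.
move=> /subsetP sKL; apply/genS/imsetS/subsetP => ij.
by rewrite !inE => /sKL.
Qed.

Lemma tperm_Tgrp K i j : [set i; j] \in K -> tperm i j \in Tgrp K.
Proof. by move=> ijK; apply/mem_gen/imsetP; exists (i, j); rewrite ?inE. Qed.

(** For [K \subset L] the coset of [b] absorbs multiplication by [Tgrp K], so it contains the coset
    of [a] as soon as it contains [a]. *)
Lemma Tcoset_sub K L a b : K \subset L ->
  (Tcoset K a \subset Tcoset L b) = (b^-1 * a \in Tgrp L).
Proof.
move=> /Tgrp_sub sKL; rewrite !TcosetE -mem_lcoset.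
apply/idP/idP => [/subsetP-> //|/lcoset_eqP <-]; first exact: lcoset_refl.
by apply: mulgS.
Qed.

Lemma face_le K L a b : K \subset E -> L \subset E ->
  (face K a <= face L b)%O = (K \subset L) && (b^-1 * a \in Tgrp L).
Proof.
move=> sK sL; rewrite (face_Cell sK) (face_Cell sL) le_Cell.
by case sKL: (K \subset L) => //=; rewrite Tcoset_sub.
Qed.

Lemma face_eq K L a b : K \subset E -> L \subset E ->
  (face K a == face L b) = (K == L) && (b^-1 * a \in Tgrp L).
Proof.
move=> sK sL; rewrite (face_Cell sK) (face_Cell sL).
have -> : (Some (Cell sK a) == Some (Cell sL b) :> P) = (Cell sK a == Cell sL b).
  by [].
rewrite Cell_eq; case: eqP => //= ->; rewrite !TcosetE -mem_lcoset.
by apply/eqP/lcoset_eqP.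
Qed.

Lemma face_le_same K L a : K \subset E -> L \subset E ->
  (face K a <= face L a)%O = (K \subset L).
Proof. by move=> sK sL; rewrite face_le // mulVg group1 andbT. Qed.

Lemma face_eq_same K L a : K \subset E -> L \subset E ->
  (face K a == face L a) = (K == L).
Proof. by move=> sK sL; rewrite face_eq // mulVg group1 andbT. Qed.

Lemma face_edge_eq K i j a : K \subset E -> [set i; j] \in K ->
  face K (a * tperm i j) = face K a.
Proof. by move=> sK ijK; apply/eqP; rewrite face_eq // eqxx mulKg tperm_Tgrp. Qed.

Lemma above_face K a x : K \subset E -> (face K a <= x)%O ->
  exists L, [/\ K \subset L, L \subset E & x = face L a].
Proof.
move=> sK; case: (faceP x) => [->|[L [b [sL ->]]]].
  by rewrite (face_Cell sK).
rewrite face_le // => /andP[sKL abL]; exists L; split=> //.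
by apply/eqP; rewrite face_eq // eqxx -groupV invMg invgK.
Qed.

(** By [above_face] every element above keeps the representative [a], so [M |-> face (K :|: M) a] is
    a bijection from the subsets of [E :\: K]. *)
Lemma card_above K a : K \subset E ->
  #|[set x : P | (face K a <= x)%O]| = (2 ^ (#|E| - #|K|))%N.
Proof.
move=> sK; have KE : E :&: K = K by apply/setIidPr.
have sUE M : M \in powerset (E :\: K) -> K :|: M \subset E.
  by rewrite inE subUset sK => /subset_trans-> //; apply: subsetDl.
rewrite -{2}KE -cardsD -card_powerset.
rewrite -(@card_in_imset _ _ (fun M => face (K :|: M) a)) => [|M N sM sN /eqP].
  apply: eq_card => x; rewrite inE; apply/idP/imsetP => [|[M sM ->]].
    case/(above_face sK)=> L [sKL sL ->]; exists (L :\: K).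
      by rewrite inE setSD.
    by rewrite -[in LHS](setID L K) (setIidPr sKL).
  by rewrite face_le_same ?sUE ?subsetUl.
rewrite face_eq_same ?sUE // => /eqP e.
have UD Q : Q \in powerset (E :\: K) -> (K :|: Q) :\: K = Q.
  rewrite inE subsetD => /andP[_ dQ].
  by rewrite setDUl setDv set0U; apply/setDidPl.
by rewrite -(UD M sM) e UD.
Qed.

Lemma edge_in i j : G i j -> [set i; j] \in E.
Proof. by move=> Gij; apply/imsetP; exists (i, j); rewrite ?inE. Qed.

Lemma edgeP e : reflect (exists i j, G i j /\ e = [set i; j]) (e \in E).
Proof.
apply: (iffP imsetP) => [[[i j]]|[i [j [Gij ->]]]].
  by rewrite inE /= => Gij ->; exists i, j.
by exists (i, j); rewrite ?inE.
Qed.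

Lemma adj_neq i j : G i j -> i != j.
Proof. by apply: contraL => /eqP ->; rewrite adj_irr. Qed.

Lemma Tgrp1 i j t : t \in Tgrp [set [set i; j]] -> t = 1 \/ t = tperm i j.
Proof.
have /subsetP sT : Tgrp [set [set i; j]] \subset <[tperm i j]>.
  rewrite gen_subG; apply/subsetP => t0 /imsetP[[x y]].
  rewrite !inE /= => /eqP e ->.
  by have [[-> ->]|[-> ->]] := eq_set2 e; rewrite 1?tpermC cycle_id.
move/sT => /cycleP[n ->]; rewrite -(odd_double_half n) expgD -mul2n expgM.
by rewrite expgS expg1 tperm2 expg1n mulg1; case: (odd n); [right | left].
Qed.

Lemma vertex_inj : injective (face set0).
Proof.
move=> a b /eqP; rewrite face_eq ?sub0set // => /andP[_].
have /trivgP-> : Tgrp (set0 : {set {set 'I_p}}) \subset [1 'S_p].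
  rewrite gen_subG; apply/subsetP => t /imsetP[ij].
  by rewrite !inE.
by move/set1P/(canRL (mulKVg _)); rewrite mulg1.
Qed.

End Faces.

(** * The two actions on faces and their commutation relation *)

Section Actions.
Variables (p : nat) (G : sgraph p).
Implicit Types (K L : {set {set 'I_p}}) (a b g h k l : 'S_p).
Local Notation E := (edges G).

Lemma right_act_face g K a : K \subset E ->
  right_act G g (face G K a) = face G K (g * a).
Proof. by move=> sK; rewrite !(face_Cell sK) right_act_Cell. Qed.

Lemma graph_act_face k K a : k \in graph_aut G -> K \subset E ->
  graph_act G k (face G K a) = face G (edges_img k K) (a ^ k).
Proof.
move=> hk sK; rewrite (face_Cell sK) (graph_act_Cell hk).
by rewrite (face_Cell (edges_img_sub hk sK)).
Qed.

Lemma perm_face_eq (s t : {perm graphicahedron G}) : s None = t None ->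
    (forall K a, K \subset E -> s (face G K a) = t (face G K a)) -> s = t.
Proof.
move=> sN st; apply/permP => x.
by case: (faceP x) => [->|[K [a [sK ->]]]] //; apply: st.
Qed.

(** [right_act g] multiplies representatives by [g] on the left in the left-to-right product, hence
    the reversal of factors. *)
Lemma right_actM g h : right_act G (g * h) = right_act G h * right_act G g.
Proof.
apply: perm_face_eq => [|K a sK]; first by rewrite permM !right_act_None.
by rewrite permM !right_act_face // mulgA.
Qed.

Lemma graph_actM k l : k \in graph_aut G -> l \in graph_aut G ->
  graph_act G (k * l) = graph_act G k * graph_act G l.
Proof.
move=> hk hl; apply: perm_face_eq => [|K a sK].
  by rewrite permM !graph_act_None.
rewrite permM !graph_act_face ?groupM ?edges_img_sub //.
by rewrite conjgM -edges_imgM.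
Qed.

Lemma face_homo_Gamma (s : {perm graphicahedron G}) : s None = None ->
    (forall K L a b, K \subset E -> L \subset E ->
       (face G K a <= face G L b)%O -> (s (face G K a) <= s (face G L b))%O) ->
  s \in Gamma G.
Proof.
move=> sN sle; apply/GammaP => x y.
case: (faceP x) => [-> _|[K [a [sK ->]]]]; first by rewrite sN le_None.
case: (faceP y) => [->|[L [b [sL ->]]]]; first by rewrite (face_Cell sK).
exact: sle.
Qed.

Lemma right_act_Gamma g : right_act G g \in Gamma G.
Proof.
apply: face_homo_Gamma => [|K L a b sK sL]; first exact: right_act_None.
by rewrite !right_act_face // !face_le // invMg mulgA mulgKV.
Qed.

Lemma graph_act_Gamma k : k \in graph_aut G -> graph_act G k \in Gamma G.
Proof.
move=> hk; apply: face_homo_Gamma => [|K L a b sK sL].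
  exact: graph_act_None.
rewrite !graph_act_face // !face_le ?edges_img_sub // => /andP[sKL ab].
by rewrite imsetS //= Tgrp_img -conjVg -conjMg memJ_conjg.
Qed.

Lemma right_act_inj : injective (right_act G).
Proof.
move=> g h /permP/(_ (face G set0 1)).
by rewrite !right_act_face ?sub0set // !mulg1 => /vertex_inj.
Qed.

Lemma right_act1 : right_act G 1 = 1.
Proof.
apply: perm_face_eq => [|K a sK]; first by rewrite perm1 right_act_None.
by rewrite perm1 right_act_face // mul1g.
Qed.

Lemma graph_act1 : graph_act G 1 = 1.
Proof. by apply: (mulgI (graph_act G 1)); rewrite -graph_actM ?group1 // !mulg1. Qed.

(** On representatives this is the identity [(g * a) ^ k = g ^ k * a ^ k]. *)
Lemma right_actJ g k : k \in graph_aut G ->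
  right_act G g ^ graph_act G k = right_act G (g ^ k).
Proof.
move=> kG; rewrite conjgE; apply: (canLR (mulKg _)).
apply: perm_face_eq => [|K a sK].
  by rewrite !permM !(right_act_None, graph_act_None).
rewrite !permM graph_act_face ?right_act_face ?graph_act_face ?edges_img_sub //.
by rewrite conjMg.
Qed.

(** On vertices [graph_act k] is conjugation by [k], so two graph automorphisms with the same action
    differ by a central element of the symmetric group. *)
Lemma graph_act_inj : p != 2 -> {in graph_aut G &, injective (graph_act G)}.
Proof.
move=> np2 k l kG lG e; apply/eqP; rewrite eq_mulgV1; apply/eqP.
apply: perm_center_trivial => [|a]; first by rewrite card_ord.
have := congr1 (fun s : {perm graphicahedron G} => s (face G set0 a)) e.
rewrite !graph_act_face ?sub0set // /edges_img !imset0 => /vertex_inj akl.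
by apply/commute_sym/commgP/conjg_fixP; rewrite conjgM akl conjgK.
Qed.

End Actions.

(** * Generation of the symmetric group by the edges of a connected graph *)

Section Connected.
Variables (p : nat) (G : sgraph p).
Hypothesis conG : connected_graph G.
Local Notation E := (edges G).

(** Follows a path from [i]: lengthening it by an edge [y z] conjugates [tperm i y] into
    [tperm i z]. The case [P 1] covers the empty path and a return to [i]. *)
Lemma tperm_conj_ind (P : 'S_p -> Prop) :
    P 1 -> (forall i j, G i j -> P (tperm i j)) ->
    (forall t i j, P t -> G i j -> P (t ^ tperm i j)) ->
  forall i j, P (tperm i j).
Proof.
move=> P1 PG PJ i j; have [_ /(_ i j)/connectP[q]] := conG.
elim/last_ind: q j => [|q z IHq] j /=; first by move=> _ ->; rewrite tperm1.
rewrite rcons_path last_rcons => /andP[pq Gyz] ->{j}.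
have := IHq _ pq erefl; move: Gyz; set y := last i q => Gyz iy.
have [-> |niy] := eqVneq i y; first exact: PG.
have [<-|niz] := eqVneq i z; first by rewrite tperm1.
have -> : tperm i z = tperm i y ^ tperm y z.
  by rewrite tpermJ tpermL tpermD // eq_sym.
exact: PJ.
Qed.

Lemma tperm_edges i j : tperm i j \in Tgrp E.
Proof.
have edge_Tgrp x y : G x y -> tperm x y \in Tgrp E.
  by move=> Gxy; apply/tperm_Tgrp/edge_in.
move: i j; apply: (tperm_conj_ind (P := fun t => t \in Tgrp E)) => //.
by move=> t x y tE Gxy; rewrite groupJ ?edge_Tgrp.
Qed.

Lemma Tgrp_edges : Tgrp E = [set: 'S_p] :> {set 'S_p}.
Proof.
apply/setP => t; rewrite inE; have [ts -> _] := prod_tpermP t.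
by apply: group_prod => xy _; apply: tperm_edges.
Qed.

(** Any vertex of the graphicahedron is reached from the identity by a walk along its edges; this is
    induction on such a walk. *)
Lemma edge_tperm_ind (P : 'S_p -> Prop) :
    P 1 -> (forall t i j, P t -> G i j -> P (t * tperm i j)) -> forall t, P t.
Proof.
move=> P1 PM t; have: t \in Tgrp E by rewrite Tgrp_edges inE.
move: t; apply: gen_ind => // t u Pt /imsetP[[i j]]; rewrite inE /= => ijE ->.
have [x [y [Gxy e]]] := edgeP _ _ ijE.
by have [[-> ->]|[-> ->]] := eq_set2 e; apply: PM; rewrite // adj_sym.
Qed.

(** A connected simple graph on two vertices has exactly one edge, namely the full vertex set. The
    bound on the number of edges thus provides a symmetric group with trivial center. *)
Lemma order_neq2 : #|E| <> 1%N -> p != 2.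
Proof.
move=> nE1; apply/eqP => p2; apply: nE1.
have card_edge e : e \in E -> e = setT.
  case/edgeP=> i [j [Gij ->]]; apply/eqP.
  by rewrite eqEcard subsetT cardsT card_ord cards2 (adj_neq Gij) p2.
apply/eqP/cards1P; exists setT; apply/setP => e; rewrite inE.
apply/idP/eqP => [/card_edge //|->].
have lt0p : 0 < p by rewrite p2.
have lt1p : 1 < p by rewrite p2.
have [_ /(_ (Ordinal lt0p) (Ordinal lt1p))] := conG.
case/connectP=> [[|z q] //= /andP[Gz _] _].
by rewrite -(card_edge _ (edge_in Gz)) edge_in.
Qed.

End Connected.

(** * The vertex map and the edge labels of a poset automorphism *)

Section Automorphisms.
Variables (p : nat) (G : sgraph p).
Hypothesis conG : connected_graph G.
Implicit Types (K L M : {set {set 'I_p}}) (a b t : 'S_p).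
Local Notation E := (edges G).
Local Notation face := (face G).
Variable s : {perm graphicahedron G}.
Hypothesis sG : s \in Gamma G.

Lemma aut_None : s None = None.
Proof.
have := le_None (s^-1 None); rewrite -(Gamma_mono sG) permKV.
by case: (s None).
Qed.

Lemma aut_face K a : K \subset E ->
  exists L b, [/\ L \subset E, #|L| = #|K| & s (face K a) = face L b].
Proof.
move=> sK; case: (faceP (s (face K a))) => [|[L [b [sL e]]]].
  by rewrite -{1}aut_None => /perm_inj/(face_neq_None sK).
exists L, b; split=> //.
have := card_above b sL; rewrite -e.
have -> : [set x | (s (face K a) <= x)%O] = s @: [set x | (face K a <= x)%O].
  apply/setP => x; rewrite -{1 2}(permKV s x) mem_imset ?inE; last exact: perm_inj.
  by rewrite (Gamma_mono sG).
rewrite card_imset; last exact: perm_inj.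
rewrite card_above // => /eqP; rewrite eqn_exp2l // => /eqP EKL.
(* Equal truncated differences give equal cardinals, because both [K] and [L] are contained in
   [E]. *)
by rewrite -(subKn (subset_leq_card sL)) -EKL subKn ?subset_leq_card.
Qed.

Lemma aut_vertex : exists f : 'S_p -> 'S_p,
  injective f /\ forall a, s (face set0 a) = face set0 (f a).
Proof.
have [f sf] : exists f : 'S_p -> 'S_p, forall a, s (face set0 a) = face set0 (f a).
  apply: (fin_all_exists (P := fun a b => s (face set0 a) = face set0 b)) => a.
  have [L [b [_ ]]] := aut_face a (sub0set E).
  by rewrite cards0 => /cards0_eq -> e; exists b.
exists f; split=> // a b e; apply: (@vertex_inj p G); apply: (@perm_inj _ s).
by rewrite !sf e.
Qed.

Variable f : 'S_p -> 'S_p.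
Hypothesis f_inj : injective f.
Hypothesis sf : forall a, s (face set0 a) = face set0 (f a).

(** The vertex [a] lies below [face K a], so [f a] lies below its image and can serve as the
    representative of that image. *)
Lemma aut_face_vertex K a : K \subset E ->
  exists L, [/\ L \subset E, #|L| = #|K| & s (face K a) = face L (f a)].
Proof.
move=> sK; have [L [b [sL cL e]]] := aut_face a sK; exists L; split=> //.
have : (s (face set0 a) <= s (face K a))%O.
  by rewrite (Gamma_mono sG) face_le_same ?sub0set.
rewrite sf e face_le ?sub0set //= => bfa; apply/eqP.
by rewrite face_eq // eqxx -groupV invMg invgK.
Qed.

(** A relation between labels, rather than a chosen function of [a] and [d], makes labels at
    different vertices directly comparable. *)
Definition edge_label a d d' := s (face [set d] a) = face [set d'] (f a).

Lemma edge_label_exists a d : d \in E -> exists2 d', d' \in E & edge_label a d d'.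
Proof.
move=> dE; have [|L [sL + e]] := @aut_face_vertex [set d] a.
  by rewrite sub1set.
rewrite cards1 => /eqP/cards1P[d' Ld]; exists d'; first by rewrite -sub1set -Ld.
by rewrite /edge_label e Ld.
Qed.

(* An edge at [a * tperm i j] is recovered from the rank two face it spans
   with the edge from [a] to [a * tperm i j]. *)
Lemma edge_label_step a d d' i j : d \in E -> d' \in E -> G i j ->
  edge_label a d d' -> edge_label (a * tperm i j) d d'.
Proof.
move=> dE d'E Gij lab; have eE := edge_in Gij; set e := [set i; j] in eE.
have s1 x : x \in E -> [set x] \subset E by rewrite sub1set.
have [e' e'E labe] := edge_label_exists a eE.
have [e2 e2E labe2] := edge_label_exists (a * tperm i j) eE.
have [d2 d2E labd2] := edge_label_exists (a * tperm i j) dE.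
have fe K : K \subset E -> e \in K -> face K (a * tperm i j) = face K a.
  exact: face_edge_eq.
(* The vertices [a] and [a * tperm i j] span the same edge of label [e], so [e] has the same image
   label at both. *)
have ee2 : e2 = e'.
  move: labe2; rewrite /edge_label fe ?s1 ?set11 // labe => /eqP.
  by rewrite face_eq ?s1 // => /andP[/eqP/set1_inj].
have [de|nde] := eqVneq d e.
  suff -> : d' = e2 by rewrite de.
  rewrite ee2; move: lab; rewrite de /edge_label labe => /eqP.
  by rewrite face_eq_same ?s1 // => /eqP/set1_inj.
have nlab a' x x' y' : x \in E -> x != e ->
    edge_label a' x x' -> edge_label a' e y' -> x' != y'.
  move=> xE nxe lx ly; apply: contra nxe => /eqP exy.
  have /perm_inj/eqP : s (face [set x] a') = s (face [set e] a').
    by rewrite lx ly exy.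
  by rewrite face_eq_same ?s1 // => /eqP/set1_inj->.
have nd'e' := nlab _ _ _ _ dE nde lab labe.
have := nlab _ _ _ _ dE nde labd2 labe2; rewrite ee2 => nd2e'.
have sde : [set d; e] \subset E by rewrite subUset !s1.
have [M [sM cM eM]] := aut_face_vertex a sde.
have [N [sN cN eN]] := aut_face_vertex (a * tperm i j) sde.
(* Likewise the rank two face with labels [d] and [e] is the same at both vertices, so its image has
   one label set. *)
have eNM : N = M.
  apply/eqP; move: eN; rewrite fe ?set22 // eM => /eqP.
  by rewrite eq_sym face_eq // => /andP[].
have inM x x' : x \in [set d; e] -> x \in E -> x' \in E -> edge_label a x x' ->
    x' \in M.
  move=> xde xE x'E lx; have : (s (face [set x] a) <= s (face [set d; e] a))%O.
    by rewrite (Gamma_mono sG) face_le_same ?s1 // sub1set.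
  by rewrite lx eM face_le_same ?s1 // sub1set.
have d2M : d2 \in M.
  have : (s (face [set d] (a * tperm i j)) <= s (face [set d; e] (a * tperm i j)))%O.
    by rewrite (Gamma_mono sG) face_le_same ?s1 // subsetUl.
  by rewrite labd2 eN eNM face_le_same ?s1 // sub1set.
have defM : [set d'; e'] = M.
  apply/eqP; rewrite eqEcard cM !cards2 nde nd'e' leqnn andbT subUset !sub1set.
  by rewrite (inM d) ?set21 // (inM e) ?set22.
(* The image face has only the labels [d'] and [e']; the new label [d2] of [d] differs from [e'],
   which leaves [d']. *)
move: d2M; rewrite -defM !inE (negPf nd2e') orbF => /eqP d2d'.
by rewrite -d2d'.
Qed.

Lemma edge_label_const a d d' : d \in E -> d' \in E ->
  edge_label 1 d d' -> edge_label a d d'.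
Proof.
move=> dE d'E lab; elim/(edge_tperm_ind conG): a => // a i j IHa Gij.
exact: edge_label_step.
Qed.

(** The image edge has only the vertices [f a] and [f a * tperm i' j'], and injectivity of [f]
    excludes the first for the other end of the edge. *)
Lemma edge_label_tperm a i j i' j' : G i j -> G i' j' ->
  edge_label a [set i; j] [set i'; j'] -> f (a * tperm i j) = f a * tperm i' j'.
Proof.
move=> /[dup] /adj_neq nij /edge_in ijE /edge_in ijE' lab.
have s1 x : x \in E -> [set x] \subset E by rewrite sub1set.
have : (s (face set0 (a * tperm i j)) <= s (face [set [set i; j]] a))%O.
  rewrite (Gamma_mono sG) face_le ?sub0set ?s1 //= mulKg.
  by rewrite tperm_Tgrp ?set11.
rewrite lab sf face_le ?sub0set ?s1 //= => /Tgrp1[] /(canRL (mulKVg _)) //.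
rewrite mulg1 => /f_inj/eqP.
by rewrite -{2}[a]mulg1 (inj_eq (mulgI a)) tperm_neq1 (negPf nij).
Qed.

Lemma aut_tperm i j : G i j ->
  exists i' j', G i' j' /\ forall a, f (a * tperm i j) = f a * tperm i' j'.
Proof.
move=> Gij; have ijE := edge_in Gij; have [d' d'E lab] := edge_label_exists 1 ijE.
have [i' [j' [Gij' dE]]] := edgeP _ _ d'E; exists i', j'; split=> // a.
by apply: edge_label_tperm => //; rewrite -dE; apply: edge_label_const.
Qed.

Hypothesis f1 : f 1 = 1.

(** Induction on [b] as a word in edge transpositions. The image [tperm i' j'] of a letter is the
    same at every vertex, so it can be split off both at [a * b] and at [b]. *)
Lemma aut_morph : {morph f : a b / a * b}.
Proof.
move=> a b; elim/(edge_tperm_ind conG): b => [|b i j IHb Gij].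
  by rewrite f1 !mulg1.
have [i' [j' [_ ft]]] := aut_tperm Gij.
by rewrite mulgA !ft IHb mulgA.
Qed.

Lemma aut_tperm_all i j : exists i' j', f (tperm i j) = tperm i' j'.
Proof.
pose P t := exists i' j', f t = tperm i' j'.
move: i j; apply: (tperm_conj_ind conG (P := P)) => [|i j Gij|t i j [x [y ft]] Gij].
- have [p_gt0 _] := conG.
  by exists (Ordinal p_gt0), (Ordinal p_gt0); rewrite f1 tperm1.
- have [x [y [_ /(_ 1)]]] := aut_tperm Gij.
  by rewrite f1 !mul1g => e; exists x, y.
have [x' [y' [_ /(_ 1)]]] := aut_tperm Gij.
rewrite f1 !mul1g => e; rewrite /P tperm_conj !aut_morph e ft -tperm_conj tpermJ.
by do 2 eexists.
Qed.

(** The conjugating [k] maps edges to edges because [f] does so on edge transpositions. That it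
    reflects adjacency follows by counting: the injective map [kk] sends the finite set of arcs onto
    itself. *)
Lemma aut_conj : p != 2 -> exists2 k, k \in graph_aut G & forall a, f a = a ^ k.
Proof.
move=> np2; have [k fk] : exists k, forall a, f a = a ^ k.
  apply: tperm_automorphism_inner aut_morph _ => //; first by rewrite card_ord.
  by move=> i j _; apply: aut_tperm_all.
exists k => //; pose A := [set ij : 'I_p * 'I_p | G ij.1 ij.2].
pose kk (ij : 'I_p * 'I_p) := (k ij.1, k ij.2).
have kk_inj : injective kk by move=> [i j] [x y] [/perm_inj-> /perm_inj->].
have Gk i j : G i j -> G (k i) (k j).
  move=> Gij; have [x [y [Gxy /(_ 1)]]] := aut_tperm Gij.
  have nkij : k i != k j by rewrite (inj_eq perm_inj) (adj_neq Gij).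
  rewrite f1 !mul1g fk tpermJ => /(eq_tperm nkij)[[-> ->]|[-> ->]] //.
  by rewrite adj_sym.
have kkA : kk @: A = A.
  apply/eqP; rewrite eqEcard card_imset // leqnn andbT.
  by apply/subsetP => u /imsetP[ij]; rewrite !inE => /Gk Gij ->.
apply/graph_autP => i j; apply/idP/idP => [Gkij|]; last exact: Gk.
have : kk (i, j) \in kk @: A by rewrite kkA inE.
by rewrite mem_imset // inE.
Qed.

End Automorphisms.

(** * Automorphisms fixing all vertices, and the factorization of an arbitrary one *)

Section FixedVertices.
Variables (p : nat) (G : sgraph p).
Hypothesis conG : connected_graph G.
Local Notation E := (edges G).
Local Notation face := (face G).

Lemma aut_fix_vertices (s : {perm graphicahedron G}) : s \in Gamma G ->
  (forall a, s (face set0 a) = face set0 a) -> s = 1.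
Proof.
move=> sG sV.
have s1 x : x \in E -> [set x] \subset E by rewrite sub1set.
(* With the identity as vertex map, an edge and its image have the same two ends, hence the same
   transposition and the same label. *)
have sE a e : e \in E -> s (face [set e] a) = face [set e] a.
  move=> eE; have [d dE lab] := edge_label_exists sG sV a eE.
  have [[i [j [Gij ee]]] [x [y [Gxy dd]]]] := (edgeP _ _ eE, edgeP _ _ dE).
  have lab' : edge_label s id a [set i; j] [set x; y] by rewrite -ee -dd.
  have /mulgI := edge_label_tperm sG (@inj_id _) sV Gij Gxy lab'.
  move/(eq_tperm (adj_neq Gij)) => exy; suff ed : e = d by rewrite {2}ed.
  by rewrite ee dd; case: exy => -[-> ->] //; rewrite setUC.
apply: perm_face_eq => [|K a sK]; first by rewrite perm1 aut_None.
rewrite perm1; have [L [sL _ eL]] := aut_face_vertex sG sV a sK.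
rewrite eL; congr (face _ a); apply/setP => e.
have [eE|neE] := boolP (e \in E); last first.
  by rewrite (contraNF (subsetP sL e) neE) (contraNF (subsetP sK e) neE).
(* The label set of a face is read off from the edges at [a] below it, and these are fixed. *)
rewrite -!sub1set -(face_le_same a (s1 _ eE) sL) -eL -{1}sE //.
by rewrite (Gamma_mono sG) face_le_same ?s1.
Qed.

Lemma Gamma_decomp (s : {perm graphicahedron G}) : p != 2 -> s \in Gamma G ->
  exists g k, k \in graph_aut G /\ s = graph_act G k * right_act G g.
Proof.
move=> np2 sG; have [f [_ sf]] := aut_vertex sG.
pose g := f 1.
pose t := s * right_act G g^-1.
have tG : t \in Gamma G by rewrite groupM ?right_act_Gamma.
(* The translation by [g^-1] brings the image of the identity vertex back, so the vertex map [h] of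
   [t] fixes [1]. *)
have [h [h_inj th]] := aut_vertex tG.
have h1 : h 1 = 1.
  apply: (@vertex_inj p G); rewrite -th permM sf right_act_face ?sub0set //.
  by rewrite mulVg.
have [k kG hk] := aut_conj conG tG h_inj th h1 np2.
have tk : t = graph_act G k.
  apply/eqP; rewrite eq_mulgV1; apply/eqP/aut_fix_vertices.
    by rewrite groupM ?groupV ?graph_act_Gamma.
  move=> a; rewrite permM th hk; apply: (canLR (permK _)).
  by rewrite graph_act_face ?sub0set // /edges_img imset0.
exists g, k; split=> //.
by rewrite -tk -mulgA -right_actM mulgV right_act1 mulg1.
Qed.

End FixedVertices.

Theorem theorem3 (p : nat) (G : sgraph p) :
  connected_graph G -> #|edges G| <> 1%N ->
  [/\ [/\ injective (right_act G) &
          forall g h : 'S_p, right_act G (g \oc h) = right_act G h \oc right_act G g],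
      [/\ {in graph_aut G &, injective (graph_act G)} &
          {in graph_aut G &, forall k l : 'S_p,
             graph_act G (k \oc l) = graph_act G k \oc graph_act G l}],
      forall (g k : 'S_p), k \in graph_aut G ->
        graph_act G k \oc right_act G g \oc (graph_act G k)^-1%g
        = right_act G (k \oc g \oc k^-1%g) &
      ([set right_act G g | g : 'S_p] ><| [set graph_act G k | k in graph_aut G])%g
      = Gamma G].
Proof.
move=> conG nE1; have np2 := order_neq2 conG nE1.
split.
- by split=> [|g h]; [apply: right_act_inj | rewrite /pcomp right_actM].
- split=> k l kG lG; last by rewrite /pcomp graph_actM.
  exact: graph_act_inj.
- by move=> g k kG; exact: right_actJ.
have gR : group_set [set right_act G g | g : 'S_p].
  apply/group_setP; split=> [|_ _ /imsetP[g _ ->] /imsetP[h _ ->]].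
    by apply/imsetP; exists 1; rewrite // right_act1.
  (* The factors are exchanged because [right_act] reverses products. *)
  by apply/imsetP; exists (h * g); rewrite // right_actM.
have gA : group_set [set graph_act G k | k in graph_aut G].
  apply/group_setP; split=> [|_ _ /imsetP[k kG ->] /imsetP[l lG ->]].
    by apply/imsetP; exists 1; rewrite ?group1 // graph_act1.
  by apply/imsetP; exists (k * l); rewrite ?groupM // graph_actM.
rewrite (@sdprodE _ (Group gR) (Group gA)) /=.
- apply/setP => s; apply/mulsgP/idP.
    case=> _ _ /imsetP[g _ ->] /imsetP[k kG ->] ->.
    by rewrite groupM ?right_act_Gamma ?graph_act_Gamma.
  case/(Gamma_decomp conG np2)=> g [k [kG ->]].
  (* [Gamma_decomp] puts the graph automorphism first; moving the translation to the left conjugates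
     it by [k^-1]. *)
  exists (right_act G (g ^ k^-1)) (graph_act G k); try exact: imset_f.
  by rewrite [RHS]conjgC right_actJ // conjgKV.
- apply/subsetP => _ /imsetP[k kG ->]; rewrite inE.
  apply/subsetP => _ /imsetP[_ /imsetP[g _ ->] ->].
  by rewrite right_actJ // imset_f.
(* Trivial intersection: at the identity vertex a translation takes the value [g], while a graph
   automorphism fixes this vertex. *)
apply/(@trivgP _ (Group gR :&: Group gA)%G)/subsetP => u /setIP[].
case/imsetP=> g _ -> /imsetP[k kG] /permP/(_ (face G set0 1)).
rewrite right_act_face ?graph_act_face ?sub0set // mulg1 conj1g /edges_img imset0.
by move/vertex_inj->; rewrite right_act1 set11.
Qed.
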